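(* Let $b\ge 4$ and $n\ge 1$ be integers, let $d$ be a positive integer with $d<b^{1/3}$, and let $c$ be an integer with $0\le c<d$ and $\gcd(c,d)=1$. Put $\alpha=\sqrt{b/d^3}$ and assume $\alpha\ge n^{3/2}+n$. Let $a$ be an integer with $\gcd(a,b)=1$ and $$0<a-b\cdot\frac cd\le \frac{\alpha}{n}-1 .$$ For each positive divisor $r$ of $n$ and each $j\in\{0,\dots,r-1\}$ put $$k(r,j)=\gcd\!\left(\tfrac nr a+jb,\ rb\right),\qquad m(r,j)=\gcd\!\left(\tfrac nr c+jd,\ rd\right),$$ $$a(r,j)=\frac{\frac nr a+jb}{k(r,j)},\quad b(r,j)=\frac{rb}{k(r,j)},\quad c(r,j)=\frac{\frac nr c+jd}{m(r,j)},\quad d(r,j)=\frac{rd}{m(r,j)}.$$ Then for every such pair $(r,j)$, the integer $a(r,j)$ is a Farey neighbour of $b(r,j)\cdot c(r,j)/d(r,j)$ (with respect to $b(r,j)$); hence $S[r,j]:=S\!\left(\tfrac nr a+jb,\ rb\right)=S(a(r,j),b(r,j))$ is positive. Moreover its expected value satisfies $$E[r,j]=\frac{m(r,j)^2}{n}\,E(a,b).$$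
   Context: For a positive integer $B$ and $A\in\mathbb Z$, the normalized Dedekind sum is $S(A,B)=12\sum_{k=1}^{B}((k/B))((Ak/B))$, where $((t))=t-\lfloor t\rfloor-1/2$ for $t\notin\mathbb Z$ and $((t))=0$ for $t\in\mathbb Z$; one has $S(Ad,Bd)=S(A,B)$ for positive integers $d$. Given a positive integer $B\ge 4$, a positive integer $D<B^{1/3}$ and an integer $C$ with $\gcd(C,D)=1$, the number $B\cdot C/D$ is called a Farey point with respect to $B$; an integer $A$ with $\gcd(A,B)=1$ is a Farey neighbour of $B\cdot C/D$ if $0\le A-B\cdot C/D\le \sqrt{B/D^3}-1$. For such $A$, with $Q=AD-BC>0$, the expected value of $S(A,B)$ is $E(A,B)=\frac{B}{DQ}$ (depending on the Farey point $B\cdot C/D$). In particular $E(a,b)=b/(dq)$ with $q=ad-bc$, and $E[r,j]=E(a(r,j),b(r,j))=\frac{b(r,j)}{d(r,j)\,q(r,j)}$ with $q(r,j)=a(r,j)d(r,j)-b(r,j)c(r,j)$. *)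

(* Defs.v *)
From HB Require Import structures.
From mathcomp Require Export all_boot all_order all_algebra.
From mathcomp Require Export reals exp.

Set Implicit Arguments.
Unset Strict Implicit.
Unset Printing Implicit Defensive.

Import Order.TTheory GRing.Theory Num.Theory.
Local Open Scope ring_scope.

Definition sawtooth (R : realType) (t : R) : R :=
  if t \is a Num.int then 0 else t - (Num.floor t)%:~R - 2^-1.

Definition dedekind_sum (R : realType) (A : int) (B : nat) : R :=
  12 * \sum_(1 <= k < B.+1)
         sawtooth (k%:R / B%:R) * sawtooth (A%:~R * k%:R / B%:R).

Definition farey_radius (R : realType) (B D : nat) : R :=
  Num.sqrt (B%:R / D%:R ^+ 3).

(* B * (C / D) is a Farey point with respect to B. *)
Definition farey_point (R : realType) (B : nat) (C : int) (D : nat) : Prop :=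
  [/\ (4 <= B)%N, (0 < D)%N, (D%:R : R) < B%:R `^ 3^-1 & coprimez C D%:Z].

(* A is a Farey neighbour of the Farey point B * (C / D). *)
Definition farey_neighbour (R : realType)
    (A : int) (B : nat) (C : int) (D : nat) : Prop :=
  [/\ farey_point R B C D, coprimez A B%:Z &
      0 <= (A%:~R : R) - B%:R * (C%:~R / D%:R) <= farey_radius R B D - 1].

Definition expected_value (R : realType)
    (A : int) (B : nat) (C : int) (D : nat) : R :=
  B%:R / (D%:R * (A * D%:Z - B%:Z * C)%:~R).

(* With (x, y) = (a, b), the following give (n/r) a + j b, k(r,j), a(r,j), b(r,j);
   with (x, y) = (c, d), they give (n/r) c + j d, m(r,j), c(r,j), d(r,j).
   All the divisions are exact when r divides n. *)
Definition hecke_num (n r j : nat) (x : int) (y : nat) : int :=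
  (n %/ r)%:Z * x + j%:Z * y%:Z.

Definition hecke_gcd (n r j : nat) (x : int) (y : nat) : nat :=
  gcdn `|hecke_num n r j x y|%N (r * y).

Definition reduced_num (n r j : nat) (x : int) (y : nat) : int :=
  (hecke_num n r j x y %/ (hecke_gcd n r j x y)%:Z)%Z.

Definition reduced_den (n r j : nat) (x : int) (y : nat) : nat :=
  ((r * y) %/ hecke_gcd n r j x y)%N.

(* Main.v *)
(* Positivity of S(A,B) for a Farey neighbour A of B C/D rests on the three-term relation
   S(A,B) = S(C,D) - S(t,Q) + (B^2 + D^2 + Q^2)/(B D Q) - 3 with Q = A D - B C,
   together with the Cauchy-Schwarz bound |S(h,k)| <= S(1,k) = (k-1)(k-2)/k: the neighbour
   condition says (Q + D)^2 D <= B, so B/(D Q) outweighs all other terms.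
   For the reduced fractions, k = k(r,j) divides n and Q(r,j) = n Q/(k m); since
   alpha sqrt(m^3/k)/r is the radius at (r,j), being a neighbour reduces to
   alpha (sqrt k - 1) >= r k - n, which is what alpha >= n^(3/2) + n provides. *)
Require Import Defs.
From mathcomp Require Import all_boot all_order all_algebra.
From mathcomp Require Import reals exp.
From mathcomp Require Import ring lra zify.

Set Implicit Arguments.
Unset Strict Implicit.
Unset Printing Implicit Defensive.

Import Order.TTheory GRing.Theory Num.Theory.
Local Open Scope ring_scope.

Lemma sum_natr (F : numFieldType) (k : nat) :
  \sum_(0 <= i < k) (i%:R : F) = k%:R * (k%:R - 1) / 2.
Proof.
elim: k => [|k IHk]; first by rewrite big_geq// !mul0r.
by rewrite big_nat_recr//= IHk -natr1; field.
Qed.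

Lemma sum_natr_sqr (F : numFieldType) (k : nat) :
  \sum_(0 <= i < k) (i%:R ^+ 2 : F) =
  k%:R * (k%:R - 1) * (2 * k%:R - 1) / 6.
Proof.
elim: k => [|k IHk]; first by rewrite big_geq// !mul0r.
by rewrite big_nat_recr//= IHk -natr1; field.
Qed.

Lemma sum_coprimez_mul (V : nmodType) (f : int -> V) (A : int) (B : nat) :
  (forall z, f (z %% B%:Z)%Z = f z) -> (0 < B)%N -> coprimez A B%:Z ->
  \sum_(0 <= i < B) f (A * i%:Z) = \sum_(0 <= i < B) f i%:Z.
Proof.
case: B => // B f_mod _ /coprimezP[[u v] /= uv1]; rewrite !big_mkord.
pose res (z : int) : 'I_B.+1 := inord `|(z %% B.+1%:Z)%Z|%N.
have resE z : (res z)%:Z = (z %% B.+1%:Z)%Z.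
  have z_ge0 : (0 <= z %% B.+1%:Z)%Z by rewrite modz_ge0.
  by rewrite inordK ?gez0_abs// -ltz_nat gez0_abs// ltz_pmod.
have mulK : cancel (fun i : 'I_B.+1 => res (A * i%:Z)) (fun i => res (u * i%:Z)).
  move=> i; apply/val_inj/eqP; rewrite -eqz_nat /= !resE modzMmr.
  have -> : u * (A * i%:Z) = (- (v * i%:Z)) * B.+1%:Z + i%:Z.
    by rewrite mulrA -[u * A](addrK (v * B.+1%:Z)) uv1; ring.
  by rewrite modzMDl modz_small//= ltz_nat ltn_ord.
rewrite [RHS](reindex_inj (can_inj mulK)) /=.
by apply: eq_bigr => i _; rewrite resE f_mod.
Qed.

Lemma coprime_mul_ndvd (h k i : nat) : coprime h k -> (0 < i < k)%N -> ~~ (k %| h * i)%N.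
Proof.
move=> hk /andP[i0 ik]; rewrite Gauss_dvdr 1?coprime_sym//.
by apply/negP => /(dvdn_leq i0); rewrite leqNgt ik.
Qed.

(* Sum [j] over the points [(i, j)] of the [k]-by-[h] rectangle, below and above the
   line [k * j = h * i]; by coprimality only points with [j = 0] lie on it. *)
Lemma sum_bin2_divn (h k : nat) : (0 < k)%N -> coprime h k ->
  (\sum_(0 <= i < k) 'C((h * i %/ k).+1, 2) +
   \sum_(0 <= j < h) j * (k * j %/ h).+1 = k * 'C(h, 2))%N.
Proof.
move=> k0 hk.
have below i : (i < k)%N ->
    'C((h * i %/ k).+1, 2) = (\sum_(0 <= j < h | k * j <= h * i) j)%N.
  move=> ik; have [->|h0] := posnP h; first by rewrite mul0n div0n big_geq.
  rewrite -bin2_sum (@big_nat_widen _ _ _ _ _ h) ?ltn_divLR ?ltn_mul2l ?h0//.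
  by apply: eq_bigl => j; rewrite ltnS leq_divRL// mulnC.
have above j : (j < h)%N ->
    (j * (k * j %/ h).+1 = \sum_(0 <= i < k | ~~ (k * j <= h * i)) j)%N.
  move=> jh; have h0 : (0 < h)%N by apply: leq_ltn_trans jh.
  have [->|j0] := posnP j; first by rewrite mul0n big1.
  have off_line : ~~ (h %| k * j)%N.
    by rewrite coprime_mul_ndvd 1?coprime_sym// j0.
  rewrite -[X in (_ * X)%N]subn0 mulnC -sum_nat_const_nat.
  rewrite (@big_nat_widen _ _ _ _ _ k) ?ltn_divLR ?ltn_mul2l ?k0//.
  apply: eq_bigl => i; rewrite ltnS -ltnNge leq_divRL// mulnC.
  rewrite leq_eqVlt orb_idl// => /eqP on_line.
  by rewrite -on_line dvdn_mulr in off_line.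
rewrite big_nat (eq_bigr _ below) -big_nat.
rewrite [X in (_ + X)%N]big_nat (eq_bigr _ above) -big_nat.
rewrite (exchange_big_dep_nat xpredT)//= -big_split /= -bin2_sum big_distrr /=.
apply: eq_bigr => j _.
transitivity (\sum_(0 <= i < k) j)%N; last by rewrite sum_nat_const_nat subn0.
by rewrite [RHS](bigID (fun i => k * j <= h * i)%N).
Qed.

Section Sawtooth.
Variable R : realType.
Implicit Types (t : R) (z : int).

Lemma sawtooth_int z : sawtooth (z%:~R : R) = 0.
Proof. by rewrite /sawtooth intr_int. Qed.

Lemma sawtooth0 : sawtooth (0 : R) = 0.
Proof. exact: (sawtooth_int 0). Qed.

Lemma sawtooth_itv01 t : 0 < t < 1 -> sawtooth t = t - 2^-1.
Proof.
move=> /andP[t0 t1]; have floor_t : Num.floor t = 0.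
  by apply: floor_def; rewrite add0r ltW.
by rewrite /sawtooth intrEfloor floor_t (lt_eqF t0) subr0.
Qed.

Lemma sawtoothDz t z : sawtooth (t + z%:~R) = sawtooth t.
Proof.
rewrite /sawtooth rpredDr ?intr_int//; case: ifP => // _.
by rewrite floorDrz ?intr_int// intrKfloor intrD; ring.
Qed.

Lemma sawtoothN t : sawtooth (- t) = - sawtooth t.
Proof.
rewrite /sawtooth rpredN; case: ifPn => [_|t_nint]; first by rewrite oppr0.
rewrite (floorNceil (- t)) opprK ceil_floor t_nint intrN intrD /=.
by field.
Qed.

Lemma sum_sawtooth_shift (d : nat) t z : (0 < d)%N ->
  \sum_(0 <= i < d) sawtooth (t + z%:~R / d%:R + i%:R / d%:R) =
  \sum_(0 <= i < d) sawtooth (t + i%:R / d%:R).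
Proof.
case: d => // d _; have dR : (d.+1%:R : R) != 0 by rewrite pnatr_eq0.
pose S x : R := \sum_(0 <= i < d.+1) sawtooth (x + i%:R / d.+1%:R).
have shift1 x : S (x + d.+1%:R^-1) = S x.
  rewrite /S big_nat_recr// [RHS]big_nat_recl//= mul0r addr0 [RHS]addrC.
  congr (_ + _).
    by apply: eq_bigr => i _; rewrite -[i.+1%:R]nat1r mulrDl mul1r addrA.
  rewrite -addrA -[X in _ + (X + _)]mul1r -mulrDl nat1r divff//.
  exact: (sawtoothDz _ 1).
have shift x (m : nat) : S (x + m%:R / d.+1%:R) = S x.
  elim: m => [|m IHm]; first by rewrite mul0r addr0.
  by rewrite -natr1 mulrDl mul1r addrA shift1.
rewrite -/(S _) -/(S t); case: z => [m|m]; first exact: shift.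
by rewrite -(shift _ m.+1) NegzE intrN mulNr subrK.
Qed.

Lemma sawtooth_distribution (d : nat) t : (0 < d)%N ->
  \sum_(0 <= i < d) sawtooth (t + i%:R / d%:R) = sawtooth (d%:R * t).
Proof.
move=> d0; have dR : 0 < (d%:R : R) by rewrite ltr0n.
have dF : (d%:R : R) != 0 by rewrite gt_eqF.
wlog t_itv : t / 0 <= d%:R * t < 1 => [reduced|].
  set z := Num.floor (d%:R * t); have /andP[z_le z_gt] := floor_itv (d%:R * t).
  rewrite -(sum_sawtooth_shift _ (- z))// reduced.
    by rewrite -[RHS](sawtoothDz _ (- z)); congr sawtooth; field.
  rewrite mulrDr mulrCA divff// mulr1 intrN subr_ge0 z_le /=.
  by rewrite ltrBlDl -[1]/(1%:~R) -intrD.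
have sum_affine : \sum_(0 <= i < d) (t + i%:R / d%:R - 2^-1) = d%:R * t - 2^-1.
  rewrite big_split big_split /= !sumr_const_nat subn0 -mulr_suml sum_natr.
  by rewrite -mulr_natl -[(- _) *+ _]mulr_natl; field.
have summand i : (0 <= i < d)%N -> 0 < t + i%:R / d%:R ->
    sawtooth (t + i%:R / d%:R) = t + i%:R / d%:R - 2^-1.
  move=> /andP[_ id] t_gt0; apply: sawtooth_itv01; rewrite t_gt0 /=.
  rewrite -(ltr_pM2l dR) mulrDr mulrCA divff// !mulr1.
  apply: (@lt_le_trans _ _ (i.+1%:R)); last by rewrite ler_nat.
  by rewrite -nat1r ltrD2r; case/andP: t_itv.
case: (eqVneq t 0) => [t0|t_neq0].
  move: sum_affine summand; rewrite {}t0 mulr0 sawtooth0 => sum_affine summand.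
  rewrite big_ltn// mul0r addr0 sawtooth0 add0r.
  rewrite big_ltn// mul0r !add0r -[RHS]addr0 in sum_affine.
  rewrite -[RHS](addrI _ sum_affine).
  rewrite !big_nat; apply: eq_bigr => i /andP[i0 id].
  by rewrite summand// add0r divr_gt0// ltr0n.
have t0 : 0 < t.
  by rewrite lt_neqAle eq_sym t_neq0 -(pmulr_rge0 _ dR); case/andP: t_itv.
rewrite [RHS]sawtooth_itv01 ?mulr_gt0//; last by case/andP: t_itv.
rewrite -sum_affine !big_nat; apply: eq_bigr => i id.
by rewrite summand// ltr_pwDl// divr_ge0.
Qed.

End Sawtooth.

Section DedekindSum.
Variable R : realType.
Implicit Types (A C z : int) (B D Q h k : nat).

Definition sawtooth_frac z k : R := sawtooth (z%:~R / k%:R).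

Lemma sawtooth_frac_eqmod z1 z2 k : (z1 = z2 %[mod k%:Z])%Z ->
  sawtooth_frac z1 k = sawtooth_frac z2 k.
Proof.
have fracDM z q : sawtooth_frac (q * k%:Z + z) k = sawtooth_frac z k.
  case: (posnP k) => [->|k0]; first by rewrite mulr0 add0r.
  rewrite -[RHS](sawtoothDz _ q); congr sawtooth.
  by rewrite intrD intrM mulrDl mulfK ?pnatr_eq0 -?lt0n// addrC.
by move=> z12; rewrite (divz_eq z1 k%:Z) z12 fracDM {2}(divz_eq z2 k%:Z) fracDM.
Qed.

Lemma sawtooth_frac0 k : sawtooth_frac 0 k = 0.
Proof. by rewrite /sawtooth_frac mul0r sawtooth0. Qed.

Lemma sawtooth_fracN z k : sawtooth_frac (- z) k = - sawtooth_frac z k.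
Proof. by rewrite /sawtooth_frac intrN mulNr sawtoothN. Qed.

Lemma sawtooth_frac_small (i k : nat) : (0 < i < k)%N ->
  sawtooth_frac i k = i%:R / k%:R - 2^-1.
Proof.
move=> /andP[i0 ik]; apply: sawtooth_itv01.
have k0 : (0 < k)%N by apply: leq_ltn_trans ik.
by rewrite divr_gt0 ?ltr0n//= ltr_pdivrMr ?ltr0n// mul1r ltr_nat.
Qed.

Lemma sawtooth_frac_divn (i k : nat) : (0 < k)%N -> ~~ (k %| i)%N ->
  sawtooth_frac i k = i%:R / k%:R - (i %/ k)%:R - 2^-1.
Proof.
move=> k0 ki; have kR : (k%:R : R) != 0 by rewrite pnatr_eq0 -lt0n.
transitivity (sawtooth_frac (i %% k)%N k).
  by apply: sawtooth_frac_eqmod; rewrite !modz_nat modn_mod.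
rewrite sawtooth_frac_small ?lt0n ?ltn_pmod ?andbT//.
by rewrite {2}(divn_eq i k) natrD natrM mulrDl mulfK// [_ + _ / _]addrC addrK.
Qed.

Lemma sum_sawtooth_frac_coprime (f : R -> R) A B : (0 < B)%N -> coprimez A B%:Z ->
  \sum_(0 <= i < B) f (sawtooth_frac (A * i%:Z) B) =
  \sum_(0 <= i < B) f (sawtooth_frac i B).
Proof.
apply: (@sum_coprimez_mul _ (fun z => f (sawtooth_frac z B))) => z.
by rewrite (@sawtooth_frac_eqmod _ z)// modz_mod.
Qed.

Lemma dedekind_sumE A B : dedekind_sum R A B =
  12 * \sum_(0 <= i < B) sawtooth_frac i B * sawtooth_frac (A * i%:Z) B.
Proof.
rewrite /dedekind_sum; case: B => [|B]; first by rewrite !big_geq.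
congr (_ * _); rewrite big_nat_recr//= [RHS]big_ltn//= sawtooth_frac0 mul0r add0r.
rewrite divff ?pnatr_eq0// (sawtooth_int R 1) mul0r addr0.
by apply: eq_bigr => i _; rewrite /sawtooth_frac intrM.
Qed.

Lemma dedekind_sum_eqmod A A' B : (A = A' %[mod B%:Z])%Z ->
  dedekind_sum R A B = dedekind_sum R A' B.
Proof.
move=> eqA; rewrite !dedekind_sumE; congr (_ * _); apply: eq_bigr => i _.
congr (_ * _); apply: sawtooth_frac_eqmod.
by rewrite -modzMml eqA modzMml.
Qed.

Lemma dedekind_sumDMl A z B : dedekind_sum R (A + z * B%:Z) B = dedekind_sum R A B.
Proof. by apply: dedekind_sum_eqmod; rewrite addrC modzMDl. Qed.

Lemma dedekind_sumN A B : dedekind_sum R (- A) B = - dedekind_sum R A B.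
Proof.
rewrite !dedekind_sumE -mulrN -sumrN; congr (_ * _).
by apply: eq_bigr => i _; rewrite mulNr sawtooth_fracN mulrN.
Qed.

Lemma dedekind_sum_den1 A : dedekind_sum R A 1 = 0.
Proof. by rewrite dedekind_sumE big_nat1 sawtooth_frac0 mul0r mulr0. Qed.

Lemma dedekind_sum_scale A B (d : nat) : (0 < d)%N ->
  dedekind_sum R (A * d%:Z) (B * d) = dedekind_sum R A B.
Proof.
move=> d0; have dR : (d%:R : R) != 0 by rewrite pnatr_eq0 -lt0n.
rewrite !dedekind_sumE; congr (_ * _).
rewrite mulnC big_nat_mul.
transitivity (\sum_(0 <= e < d) \sum_(0 <= i < B)
    sawtooth (i%:R / (d * B)%:R + e%:R / d%:R : R) * sawtooth_frac (A * i%:Z) B).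
  apply: eq_bigr => e _; rewrite mulSn -{1}[(e * B)%N]add0n big_addn addnK.
  rewrite !big_nat; apply: eq_bigr => i /andP[_ iB]; congr (_ * _).
    congr sawtooth; rewrite -pmulrn natrD !natrM; field.
    by rewrite dR pnatr_eq0; lia.
  transitivity (sawtooth_frac (A * (i + e * B)%N) B).
    rewrite /sawtooth_frac; congr sawtooth.
    rewrite !intrM -!pmulrn natrM; field.
    by rewrite dR pnatr_eq0; lia.
  by apply: sawtooth_frac_eqmod; rewrite PoszD PoszM mulrDr mulrA addrC modzMDl.
rewrite exchange_big_nat /= !big_nat; apply: eq_bigr => i /andP[_ iB].
rewrite -mulr_suml sawtooth_distribution//; congr (sawtooth _ * _).
rewrite natrM; field.
by rewrite dR pnatr_eq0; lia.
Qed.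

Lemma mul_sawtooth_fracM (i k : nat) (z : int) : (i < k)%N ->
  sawtooth_frac i k * sawtooth_frac (z * i%:Z) k =
  (i%:R / k%:R - 2^-1) * sawtooth_frac (z * i%:Z) k.
Proof.
move=> ik; case: (posnP i) => [->|i0]; first by rewrite mulr0 sawtooth_frac0 !mulr0.
by rewrite sawtooth_frac_small// i0.
Qed.

Lemma sum_sawtooth_frac_eq0 k : (0 < k)%N -> \sum_(0 <= i < k) sawtooth_frac i k = 0.
Proof.
move=> k0; have := sawtooth_distribution (0 : R) k0.
by rewrite mulr0 sawtooth0; under eq_bigr => i _ do rewrite add0r.
Qed.

Lemma dedekind_sum_coprimeE A B : (0 < B)%N -> coprimez A B%:Z ->
  dedekind_sum R A B =
  12 / B%:R * \sum_(0 <= i < B) i%:R * sawtooth_frac (A * i%:Z) B.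
Proof.
move=> B0 cAB; rewrite dedekind_sumE -mulrA; congr (_ * _).
transitivity (\sum_(0 <= i < B) (B%:R^-1 * (i%:R * sawtooth_frac (A * i%:Z) B)
    - 2^-1 * sawtooth_frac (A * i%:Z) B)).
  rewrite !big_nat; apply: eq_bigr => i /andP[_ iB].
  by rewrite mul_sawtooth_fracM// mulrBl mulrA [B%:R^-1 * _]mulrC.
rewrite sumrB -!mulr_sumr (sum_sawtooth_frac_coprime id)// sum_sawtooth_frac_eq0//.
by rewrite mulr0 subr0.
Qed.

Lemma dedekind_sum1 B : (0 < B)%N ->
  dedekind_sum R 1 B = (B%:R - 1) * (B%:R - 2) / B%:R.
Proof.
move=> B0; have BR : (B%:R : R) != 0 by rewrite pnatr_eq0 -lt0n.
rewrite dedekind_sum_coprimeE//; last by rewrite /coprimez gcd1z.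
transitivity (12 / B%:R * \sum_(0 <= i < B) (B%:R^-1 * i%:R ^+ 2 - 2^-1 * i%:R) : R).
  congr (_ * _); rewrite !big_nat; apply: eq_bigr => i /andP[_ iB].
  case: (posnP i) => [->|i0]; first by rewrite expr2 !(mul0r, mulr0) subrr.
  by rewrite mul1r sawtooth_frac_small ?i0//; ring.
by rewrite sumrB -!mulr_sumr sum_natr sum_natr_sqr; field.
Qed.

Lemma sum_sawtooth_frac_sqr B :
  \sum_(0 <= i < B) sawtooth_frac i B ^+ 2 = dedekind_sum R 1 B / 12.
Proof.
rewrite dedekind_sumE mulrC mulKf ?pnatr_eq0//.
by apply: eq_bigr => i _; rewrite mul1r expr2.
Qed.

Lemma dedekind_sum_norm_le A B : (0 < B)%N -> coprimez A B%:Z ->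
  `|dedekind_sum R A B| <= dedekind_sum R 1 B.
Proof.
move=> B0; have ge_opp A' : coprimez A' B%:Z ->
    - dedekind_sum R 1 B <= dedekind_sum R A' B.
  move=> cAB; rewrite -subr_ge0 opprK.
  have -> : dedekind_sum R A' B + dedekind_sum R 1 B =
      6 * \sum_(0 <= i < B) (sawtooth_frac i B + sawtooth_frac (A' * i%:Z) B) ^+ 2.
    under eq_bigr => i _ do rewrite sqrrD -mulr_natl.
    rewrite !big_split /= -mulr_sumr (sum_sawtooth_frac_coprime (fun x => x ^+ 2))//.
    by rewrite sum_sawtooth_frac_sqr (dedekind_sumE A'); field.
  by rewrite mulr_ge0// sumr_ge0// => i _; rewrite sqr_ge0.
move=> cAB; rewrite ler_norml ge_opp//= -lerN2 -(dedekind_sumN A) ge_opp//.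
by rewrite coprimeNz.
Qed.

Lemma natr_divn_sawtooth h k (i : nat) : coprime h k -> (0 < i < k)%N ->
  ((h * i %/ k)%:R : R) = h%:R / k%:R * i%:R - sawtooth_frac (h%:Z * i%:Z) k - 2^-1.
Proof.
move=> hk ik; have k0 : (0 < k)%N by case/andP: ik => _; apply: leq_ltn_trans.
by rewrite -PoszM sawtooth_frac_divn ?coprime_mul_ndvd// natrM; ring.
Qed.

Lemma sum_mul_divn_dedekind h k : (0 < k)%N -> coprime h k ->
  \sum_(0 <= i < k) (i * (h * i %/ k).+1)%:R =
  h%:R / k%:R * \sum_(0 <= i < k) i%:R ^+ 2 + (\sum_(0 <= i < k) i%:R) / 2
  - k%:R * dedekind_sum R h k / 12.
Proof.
move=> k0 hk; have kR : (k%:R : R) != 0 by rewrite pnatr_eq0 -lt0n.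
have -> : k%:R * dedekind_sum R h k / 12 =
    \sum_(0 <= i < k) i%:R * sawtooth_frac (h%:Z * i%:Z) k.
  by rewrite dedekind_sum_coprimeE// ?coprimezE//; field.
rewrite mulr_suml mulr_sumr -big_split -sumrB /= !big_nat.
apply: eq_bigr => i /andP[_ ik]; have [->|i0] := posnP i.
  by rewrite expr2 !(mul0r, mulr0) addr0 subrr.
by rewrite natrM -natr1 natr_divn_sawtooth ?i0//; field.
Qed.

(* [q (q + 1) = (q + 1/2)^2 - 1/4], where [q + 1/2] is [h i / k] minus its sawtooth. *)
Lemma sum_bin2_divn_dedekind h k : (0 < k)%N -> coprime h k ->
  2 * \sum_(0 <= i < k) ('C((h * i %/ k).+1, 2))%:R =
  (h%:R / k%:R) ^+ 2 * \sum_(0 <= i < k) i%:R ^+ 2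
  - h%:R * dedekind_sum R h k / 6 + dedekind_sum R 1 k / 12 - (k%:R - 1) / 4.
Proof.
move=> k0 hk; have kR : (k%:R : R) != 0 by rewrite pnatr_eq0 -lt0n.
have -> : h%:R * dedekind_sum R h k / 6 =
    2 * (h%:R / k%:R) * \sum_(0 <= i < k) i%:R * sawtooth_frac (h%:Z * i%:Z) k.
  by rewrite dedekind_sum_coprimeE// ?coprimezE//; field.
rewrite -sum_sawtooth_frac_sqr.
rewrite -(@sum_sawtooth_frac_coprime (fun t => t ^+ 2) h)// ?coprimezE//.
have -> : (k%:R - 1) / 4 = \sum_(1 <= i < k) 4^-1 :> R.
  by rewrite sumr_const_nat -[RHS]mulr_natl natrB.
have drop0 (f : nat -> R) : f 0%N = 0 -> \sum_(0 <= i < k) f i = \sum_(1 <= i < k) f i.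
  by move=> f0; rewrite big_ltn// f0 add0r.
rewrite !drop0 ?muln0 ?div0n ?bin_small ?mulr0 ?sawtooth_frac0 ?mul0r ?expr0n//.
rewrite !mulr_sumr -sumrB -big_split -sumrB !big_nat /=.
apply: eq_bigr => i ik; rewrite -natrM.
have -> : (2 * 'C((h * i %/ k).+1, 2) = (h * i %/ k).+1 * (h * i %/ k))%N.
  by rewrite -mul_bin_diag bin1.
by rewrite natrM -natr1 natr_divn_sawtooth//; field.
Qed.

Theorem dedekind_reciprocity h k : (0 < h)%N -> (0 < k)%N -> coprime h k ->
  dedekind_sum R h k + dedekind_sum R k h =
  h%:R / k%:R + k%:R / h%:R + (h%:R * k%:R)^-1 - 3.
Proof.
move=> h0 k0 hk; have kh : coprime k h by rewrite coprime_sym.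
have hR : (h%:R : R) != 0 by rewrite pnatr_eq0 -lt0n.
have kR : (k%:R : R) != 0 by rewrite pnatr_eq0 -lt0n.
have := congr1 (fun n => 2 * n%:R : R) (sum_bin2_divn k0 hk).
rewrite natrD mulrDr !natr_sum sum_bin2_divn_dedekind// sum_mul_divn_dedekind//.
rewrite natrM -bin2_sum natr_sum !sum_natr !sum_natr_sqr dedekind_sum1// => lattice_sum.
(* The claim, scaled by [- h / 6], is [lattice_sum]. *)
have h6 : - (h%:R / 6) != 0 :> R by rewrite oppr_eq0 mulf_neq0// invr_eq0 pnatr_eq0.
move/eqP: lattice_sum; rewrite -subr_eq0 => /eqP lattice_sum.
apply/eqP; rewrite -subr_eq0 -(mulrI_eq0 _ (mulfI h6)); apply/eqP.
by rewrite -[RHS]lattice_sum; field; rewrite hR.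
Qed.

(* [Q] and [t] stand for [A D - B C] and [x A + y B], where [x C + y D = 1]. *)
Definition three_term A B C D Q (t : int) : Prop :=
  dedekind_sum R A B = dedekind_sum R C D - dedekind_sum R t Q
    + (B%:R ^+ 2 + D%:R ^+ 2 + Q%:R ^+ 2) / (B%:R * D%:R * Q%:R) - 3.

Lemma three_termDMl A B C D Q (t z : int) :
  three_term (A + z * B%:Z) B (C + z * D%:Z) D Q t -> three_term A B C D Q t.
Proof. by rewrite /three_term !dedekind_sumDMl. Qed.

Lemma three_term01 (A B : nat) (z : int) :
  (0 < A)%N -> (0 < B)%N -> coprime A B -> three_term A B 0 1 A (z * A%:Z + B%:Z).
Proof.
move=> A0 B0 cAB; have recAB := dedekind_reciprocity A0 B0 cAB.
have AR : (A%:R : R) != 0 by rewrite pnatr_eq0 -lt0n.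
have BR : (B%:R : R) != 0 by rewrite pnatr_eq0 -lt0n.
rewrite /three_term dedekind_sum_den1 addrC [z * _ + _]addrC dedekind_sumDMl.
by rewrite (canRL (addrK _) recAB); field; rewrite AR BR.
Qed.

Lemma three_term_swap (A B C D Q : nat) (t : int) :
  (0 < A)%N -> (0 < B)%N -> (0 < C)%N -> (0 < D)%N -> (0 < Q)%N ->
  coprime A B -> coprime C D -> A%:Z * D%:Z - B%:Z * C%:Z = Q%:Z ->
  three_term (- B%:Z) A (- D%:Z) C Q t -> three_term A B C D Q t.
Proof.
move=> A0 B0 C0 D0 Q0 cAB cCD detQ; rewrite /three_term !dedekind_sumN => three_term_BA.
have recAB := dedekind_reciprocity A0 B0 cAB.
have recCD := dedekind_reciprocity C0 D0 cCD.
have AR : (A%:R : R) != 0 by rewrite pnatr_eq0 -lt0n.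
have BR : (B%:R : R) != 0 by rewrite pnatr_eq0 -lt0n.
have CR : (C%:R : R) != 0 by rewrite pnatr_eq0 -lt0n.
have DR : (D%:R : R) != 0 by rewrite pnatr_eq0 -lt0n.
have QR : (Q%:R : R) != 0 by rewrite pnatr_eq0 -lt0n.
have detQR : (Q%:R : R) = A%:R * D%:R - B%:R * C%:R.
  by have := congr1 (fun z : int => z%:~R : R) detQ; rewrite intrB !intrM.
rewrite (canRL (addrK _) recAB) (canRL (addrK _) recCD) three_term_BA.
by rewrite detQR in QR *; field; rewrite QR AR BR CR DR.
Qed.

(* The relation is invariant under [SL_2(Z)] acting simultaneously on [A/B] and [C/D],
   so the Euclidean algorithm on [C/D] reduces it to [C/D = 0/1]. *)
Theorem dedekind_three_term A C (x y : int) B D Q :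
  (0 < B)%N -> (0 < D)%N -> (0 < Q)%N -> coprimez A B%:Z ->
  x * C + y * D%:Z = 1 -> A * D%:Z - B%:Z * C = Q%:Z ->
  three_term A B C D Q (x * A + y * B%:Z).
Proof.
elim/ltn_ind: D A C x y B => D IH A C x y B B0 D0 Q0 cAB xy1 detQ.
wlog : A C y cAB xy1 detQ / 0 <= C < D%:Z => [reduced|].
  pose z := - (C %/ D%:Z)%Z; apply: (@three_termDMl _ _ _ _ _ _ z).
  have -> : x * A + y * B%:Z = x * (A + z * B%:Z) + (y - z * x) * B%:Z by ring.
  apply: reduced; first by rewrite /coprimez gcdzC addrC gcdzMDl gcdzC.
  - by rewrite -xy1; ring.
  - by rewrite -detQ; ring.
  have -> : C + z * D%:Z = (C %% D%:Z)%Z by rewrite mulNr.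
  by rewrite modz_ge0 ?ltz_pmod//; lia.
case: C xy1 detQ => // C xy1 detQ /andP[_ CD].
have A_gt0 : 0 < A by nia.
case: A A_gt0 cAB detQ => // A A0 cAB detQ.
have [C0|C0] := posnP C.
  have yD1 : y * D%:Z = 1 by rewrite -xy1 C0 mulr0 add0r.
  have D1 : D = 1%N by apply/eqP; rewrite -dvdn1; apply/(@dvdzP D 1); exists y.
  have QA : Q = A by move: detQ; rewrite C0 D1 mulr0 subr0 mulr1 => -[].
  have y1 : y = 1 by rewrite -yD1 D1 mulr1.
  by rewrite C0 D1 QA y1 mul1r; apply: three_term01.
have cCD : coprime C D by apply/(@coprimezP C D); exists (x, y).
apply: three_term_swap => //.
have -> : x * A%:Z + y * B%:Z = - y * - B%:Z + x * A%:Z by ring.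
apply: IH => //; first by rewrite coprimeNz coprimezE coprime_sym.
- by rewrite -xy1; ring.
- by rewrite -detQ; ring.
Qed.

End DedekindSum.

Definition farey_det (A : int) (B : nat) (C : int) (D : nat) : int :=
  A * D%:Z - B%:Z * C.

Section FareyNeighbour.
Variable R : realType.
Implicit Types (A C : int) (B D Q : nat).

Lemma lt_powR_invn (x y : R) (n : nat) : 0 <= x -> 0 <= y -> (0 < n)%N ->
  (x < y `^ n%:R^-1) = (x ^+ n < y).
Proof.
move=> x0 y0 n0; rewrite -(ltr_pXn2r n0) ?nnegrE ?powR_ge0//.
by rewrite -(powR_mulrn n (powR_ge0 _ _)) -powRrM mulVf ?pnatr_eq0 -?lt0n// powRr1.
Qed.

Lemma powR32_sqrt (x : R) : 0 <= x -> x `^ (3 / 2) = x * Num.sqrt x.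
Proof.
move=> x0; rewrite (_ : 3 / 2 = 1 + 2^-1); last by field.
by rewrite powRD ?powRr1 ?powR12_sqrt//; apply/implyP => /eqP; lra.
Qed.

Lemma farey_distE A B C D : (0 < D)%N ->
  A%:~R - B%:R * (C%:~R / D%:R) = (farey_det A B C D)%:~R / D%:R :> R.
Proof.
move=> D0; have DR : (D%:R : R) != 0 by rewrite pnatr_eq0 -lt0n.
by rewrite /farey_det intrB !intrM -!pmulrn; field.
Qed.

Lemma farey_radius_sqr B D : farey_radius R B D ^+ 2 = B%:R / D%:R ^+ 3.
Proof. by rewrite sqr_sqrtr// divr_ge0// exprn_ge0. Qed.

Lemma farey_radius_gt1 B D : (0 < B)%N -> (0 < D)%N ->
  (1 < farey_radius R B D) = (D%:R < B%:R `^ 3^-1 :> R).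
Proof.
move=> B0 D0; have DR : 0 < (D%:R : R) ^+ 3 by rewrite exprn_gt0 ?ltr0n.
rewrite lt_powR_invn// -[X in X < _]sqrtr1 ltr_sqrt ?divr_gt0 ?ltr0n//.
by rewrite ltr_pdivlMr// mul1r.
Qed.

Lemma natr_le_farey_radius B D (x : nat) : (0 < D)%N ->
  x%:R <= farey_radius R B D -> (x ^ 2 * D ^ 3 <= B)%N.
Proof.
move=> D0 x_le; rewrite -(ler_nat R) natrM !natrX -ler_pdivlMr ?exprn_gt0 ?ltr0n//.
by rewrite -farey_radius_sqr ler_sqr ?nnegrE ?sqrtr_ge0.
Qed.

Lemma farey_neighbour_den_ge A B C D Q :
  farey_neighbour R A B C D -> farey_det A B C D = Q ->
  ((Q + D) ^ 2 * D <= B)%N.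
Proof.
move=> [[_ D0 _ _] _ /andP[_]] + detQ; rewrite farey_distE// detQ => dist_le.
have DR : 0 < (D%:R : R) by rewrite ltr0n.
have : (Q%:R / D%:R + 1) ^+ 2 <= farey_radius R B D ^+ 2.
  by rewrite ler_sqr ?nnegrE ?sqrtr_ge0 ?addr_ge0 ?divr_ge0// -lerBrDr.
rewrite farey_radius_sqr ler_pdivlMr ?exprn_gt0// -(ler_nat R) natrM natrX natrD.
suff -> : (Q%:R / D%:R + 1) ^+ 2 * D%:R ^+ 3 = (Q%:R + D%:R) ^+ 2 * D%:R :> R by [].
by field; rewrite gt_eqF.
Qed.

Lemma dedekind_sum1D_lt D Q : (0 < D)%N -> (0 < Q)%N ->
  dedekind_sum R 1 D + dedekind_sum R 1 Q + 3 < (Q%:R + D%:R) ^+ 2 / Q%:R.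
Proof.
move=> D0 Q0; rewrite !dedekind_sum1//.
have [DR QR] : 0 < (D%:R : R) /\ 0 < (Q%:R : R) by rewrite !ltr0n.
have expand (k : R) : 0 < k -> (k - 1) * (k - 2) / k = k - 3 + 2 / k.
  by move=> k0; field; rewrite gt_eqF.
have -> : (Q%:R + D%:R) ^+ 2 / Q%:R = Q%:R + 2 * D%:R + D%:R ^+ 2 / Q%:R :> R.
  by field; rewrite gt_eqF.
rewrite !expand//.
have D1 : 1 <= (D%:R : R) by rewrite ler1n.
have D2 : 2 / D%:R <= 2 :> R by rewrite ler_pdivrMr// ler_peMr.
have Q2 : 2 / Q%:R <= 2 :> R by rewrite ler_pdivrMr// ler_peMr// ler1n.
have DQ : 0 < D%:R ^+ 2 / Q%:R :> R by rewrite divr_gt0 ?exprn_gt0.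
lra.
Qed.

Theorem dedekind_sum_gt0 A B C D :
  farey_neighbour R A B C D -> 0 < farey_det A B C D -> 0 < dedekind_sum R A B.
Proof.
move=> neighbour det_gt0; have [[B4 D0 _ cCD] cAB _] := neighbour.
have B0 : (0 < B)%N by apply: leq_trans B4.
case detQ: (farey_det A B C D) det_gt0 => [Q|//]; rewrite ltz_nat => Q0.
have [[x y] /= xy1] := coprimezP _ _ cCD.
have [[u v] /= uv1] := coprimezP _ _ cAB.
have ct : coprimez (x * A + y * B%:Z) Q%:Z.
  apply/coprimezP; exists (u * C + v * D%:Z, u * y - v * x) => /=.
  by rewrite -uv1 -detQ /farey_det -[u * A]mulr1 -[v * B%:Z]mulr1 -xy1; ring.
rewrite (dedekind_three_term R B0 D0 Q0 cAB xy1 detQ).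
have := dedekind_sum_norm_le R D0 cCD; rewrite ler_norml => /andP[boundC _].
have := dedekind_sum_norm_le R Q0 ct; rewrite ler_norml => /andP[_ boundQ].
have BR : 0 < (B%:R : R) by rewrite ltr0n.
have := dedekind_sum1D_lt D0 Q0.
have : (Q%:R + D%:R) ^+ 2 / Q%:R <=
    (B%:R ^+ 2 + D%:R ^+ 2 + Q%:R ^+ 2) / (B%:R * D%:R * Q%:R) :> R; last by lra.
have := farey_neighbour_den_ge neighbour detQ.
rewrite -(ler_nat R) natrM natrX natrD -(ler_pM2l BR) => den_ge.
have [DR QR] : 0 < (D%:R : R) /\ 0 < (Q%:R : R) by rewrite !ltr0n.
rewrite ler_pdivlMr ?mulr_gt0// (_ : _ / _ * _ = B%:R * ((Q%:R + D%:R) ^+ 2 * D%:R)).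
  by apply: le_trans den_ge _; rewrite -expr2 -addrA lerDl addr_ge0 ?sqr_ge0.
by field; rewrite gt_eqF.
Qed.

End FareyNeighbour.

Lemma farey_neighbour_slack (F : realFieldType) (alpha n r s : F) :
  1 <= s -> 0 < r <= n -> n * (s + 1) <= alpha ->
  (alpha - n) / (r * s ^+ 2) + 1 <= alpha / (s * r).
Proof.
move=> s1 /andP[r0 rn] alpha_ge; have s0 : 0 < s by apply: lt_le_trans s1.
have [r_neq0 s_neq0] := (lt0r_neq0 r0, lt0r_neq0 s0).
have -> : alpha / (s * r) = alpha * s / (r * s ^+ 2).
  by field; rewrite r_neq0 s_neq0.
rewrite ler_pdivlMr ?mulr_gt0 ?exprn_gt0// mulrDl mul1r divfK; last first.
  by rewrite mulf_neq0 ?expf_neq0.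
have : n * (s + 1) * (s - 1) <= alpha * (s - 1) by rewrite ler_wpM2r ?subr_ge0.
have : r * s ^+ 2 <= n * s ^+ 2 by rewrite ler_pM2r ?exprn_gt0.
have -> : n * (s + 1) * (s - 1) = n * s ^+ 2 - n by ring.
lra.
Qed.

Section HeckeReduction.
Variables n r j : nat.
Implicit Types (x : int) (y : nat).

Local Notation num := (reduced_num n r j).
Local Notation den := (reduced_den n r j).
Local Notation hgcd := (hecke_gcd n r j).

Lemma reduced_numK x y : num x y * (hgcd x y)%:Z = hecke_num n r j x y.
Proof. by apply: divzK; exact: dvdn_gcdl. Qed.

Lemma reduced_denK x y : (den x y * hgcd x y = r * y)%N.
Proof. by apply: divnK; exact: dvdn_gcdr. Qed.

Lemma hecke_gcd_dvd x y : (r %| n)%N -> coprimez x y%:Z -> (hgcd x y %| n)%N.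
Proof.
move=> rn /coprimezP[[u v] /= uv1].
rewrite -[(_ %| _)%N]/((hgcd x y)%:Z %| n%:Z)%Z.
have -> : n%:Z = u * r%:Z * hecke_num n r j x y +
    ((n %/ r)%:Z * v - u * j%:Z) * (r * y)%:Z.
  by rewrite /hecke_num -{1}(divnK rn) !PoszM -[LHS]mulr1 -uv1; ring.
by apply: rpredD; apply: dvdz_mull; [exact: dvdn_gcdl | exact: dvdn_gcdr].
Qed.

Lemma farey_det_reduced (a c : int) (b d : nat) : (r %| n)%N ->
  farey_det (num a b) (den a b) (num c d) (den c d) *
    ((hgcd a b)%:Z * (hgcd c d)%:Z) = n%:Z * farey_det a b c d.
Proof.
move=> rn; rewrite /farey_det.
transitivity (hecke_num n r j a b * (r * d)%N%:Z - (r * b)%N%:Z * hecke_num n r j c d).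
  rewrite -(reduced_denK a b) -(reduced_denK c d) !PoszM.
  by rewrite -(reduced_numK a b) -(reduced_numK c d); ring.
by rewrite /hecke_num -{3}(divnK rn) !PoszM; ring.
Qed.

Hypothesis r_gt0 : (0 < r)%N.

Lemma hecke_gcd_gt0 x y : (0 < y)%N -> (0 < hgcd x y)%N.
Proof. by move=> y0; rewrite gcdn_gt0 muln_gt0 r_gt0 y0 orbT. Qed.

Lemma reduced_den_gt0 x y : (0 < y)%N -> (0 < den x y)%N.
Proof.
move=> y0; rewrite divn_gt0 ?hecke_gcd_gt0//.
by rewrite dvdn_leq ?dvdn_gcdr// muln_gt0 r_gt0.
Qed.

Lemma coprimez_reduced x y : (0 < y)%N -> coprimez (num x y) (den x y)%:Z.
Proof.
move=> y0; rewrite coprimezE /coprime -(eqn_pmul2r (hecke_gcd_gt0 x y0)) mul1n muln_gcdl.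
have -> : (`|num x y| * hgcd x y)%N = `|hecke_num n r j x y|%N.
  by rewrite -reduced_numK abszM.
by rewrite reduced_denK.
Qed.

Lemma farey_det_reduced_gt0 (a c : int) (b d : nat) :
  (0 < n)%N -> (0 < b)%N -> (0 < d)%N -> (r %| n)%N -> 0 < farey_det a b c d ->
  0 < farey_det (num a b) (den a b) (num c d) (den c d).
Proof.
move=> n0 b0 d0 rn det_gt0.
have gcds_gt0 : 0 < (hgcd a b)%:Z * (hgcd c d)%:Z.
  by rewrite mulr_gt0// ltz_nat hecke_gcd_gt0.
by rewrite -(pmulr_lgt0 _ gcds_gt0) farey_det_reduced// mulr_gt0.
Qed.

Section Neighbour.
Variables (R : realType) (a c : int) (b d : nat).
Hypotheses (n_gt0 : (0 < n)%N) (b_gt0 : (0 < b)%N) (d_gt0 : (0 < d)%N).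
Hypothesis rn : (r %| n)%N.

Let k := hgcd a b.
Let m := hgcd c d.

Let k_neq0 : (k%:R : R) != 0. Proof. by rewrite pnatr_eq0 -lt0n hecke_gcd_gt0. Qed.
Let m_neq0 : (m%:R : R) != 0. Proof. by rewrite pnatr_eq0 -lt0n hecke_gcd_gt0. Qed.
Let n_neq0 : (n%:R : R) != 0. Proof. by rewrite pnatr_eq0 -lt0n. Qed.
Let r_neq0 : (r%:R : R) != 0. Proof. by rewrite pnatr_eq0 -lt0n. Qed.
Let d_neq0 : (d%:R : R) != 0. Proof. by rewrite pnatr_eq0 -lt0n. Qed.

Lemma natr_reduced_den x y : (0 < y)%N ->
  (den x y)%:R = r%:R * y%:R / (hgcd x y)%:R :> R.
Proof.
move=> y0; rewrite -natrM -(reduced_denK x y) natrM mulfK//.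
by rewrite pnatr_eq0 -lt0n hecke_gcd_gt0.
Qed.

Lemma intr_farey_det_reduced :
  (farey_det (num a b) (den a b) (num c d) (den c d))%:~R =
  n%:R * (farey_det a b c d)%:~R / (k%:R * m%:R) :> R.
Proof.
apply: (canRL (mulfK _)); first by rewrite mulf_neq0.
have := congr1 (fun z : int => z%:~R : R) (farey_det_reduced a c b d rn).
by rewrite !intrM.
Qed.

Lemma expected_value_reduced :
  expected_value R (num a b) (den a b) (num c d) (den c d) =
  m%:R ^+ 2 / n%:R * expected_value R a b c d.
Proof.
rewrite /expected_value -!/(farey_det _ _ _ _) intr_farey_det_reduced.
rewrite !natr_reduced_den// -/k -/m.
have [->|det_neq0] := eqVneq ((farey_det a b c d)%:~R : R) 0.
  by rewrite !(mulr0, mul0r, invr0).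
by field; rewrite det_neq0 d_neq0 n_neq0 r_neq0 k_neq0 m_neq0.
Qed.

Lemma farey_radius_reduced_ge :
  farey_radius R b d / (Num.sqrt k%:R * r%:R) <= farey_radius R (den a b) (den c d).
Proof.
rewrite -ler_sqr ?nnegrE ?sqrtr_ge0 ?divr_ge0 ?mulr_ge0 ?sqrtr_ge0//.
rewrite expr_div_n exprMn !farey_radius_sqr sqr_sqrtr// !natr_reduced_den// -/k -/m.
have -> : r%:R * b%:R / k%:R / (r%:R * d%:R / m%:R) ^+ 3 =
    b%:R / d%:R ^+ 3 / (k%:R * r%:R ^+ 2) * m%:R ^+ 3 :> R.
  by field; rewrite d_neq0 r_neq0 k_neq0 m_neq0.
by rewrite ler_peMr ?divr_ge0 ?mulr_ge0 ?exprn_ge0// exprn_ege1// ler1n hecke_gcd_gt0.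
Qed.

Hypothesis cab : coprimez a b%:Z.
Hypothesis radius_ge : n%:R * (Num.sqrt n%:R + 1) <= farey_radius R b d.

Let kn : (k <= n)%N. Proof. by apply: dvdn_leq => //; exact: hecke_gcd_dvd. Qed.
Let rlen : (r <= n)%N. Proof. exact: dvdn_leq. Qed.

Lemma farey_point_reduced : farey_point R (den a b) (num c d) (den c d).
Proof.
have k0 : (0 < k)%N by rewrite hecke_gcd_gt0.
split; [| exact: reduced_den_gt0 | | exact: coprimez_reduced].
  have n2_le : (2 * n)%:R <= farey_radius R b d.
    apply: le_trans radius_ge; rewrite natrM mulrC ler_pM2l ?ltr0n//.
    by rewrite -[2]/(1 + 1) lerD2r -[leLHS]sqrtr1 ler_wsqrtr// ler1n.
  have n4_le : (4 * n <= b)%N.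
    apply: leq_trans (natr_le_farey_radius d_gt0 n2_le).
    rewrite expnMn -mulnA leq_mul2l /= -mulnA leq_pmulr//.
    by rewrite muln_gt0 n_gt0 expn_gt0 d_gt0.
  rewrite -(leq_pmul2r k0) reduced_denK (leq_trans _ (leq_pmull b r_gt0))//.
  by rewrite (leq_trans _ n4_le)// leq_mul2l kn.
rewrite -farey_radius_gt1 ?reduced_den_gt0//; apply: lt_le_trans farey_radius_reduced_ge.
rewrite ltr_pdivlMr ?mul1r ?mulr_gt0 ?sqrtr_gt0 ?ltr0n//; apply: lt_le_trans radius_ge.
rewrite mulrC mulrDr mulr1; apply: (@le_lt_trans _ _ (n%:R * Num.sqrt n%:R)).
  by rewrite ler_pM ?sqrtr_ge0// ?ler_wsqrtr// ler_nat.
by rewrite ltrDl ltr0n.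
Qed.

Lemma farey_neighbour_reduced : 0 <= farey_det a b c d ->
  a%:~R - b%:R * (c%:~R / d%:R) <= farey_radius R b d / n%:R - 1 ->
  farey_neighbour R (num a b) (den a b) (num c d) (den c d).
Proof.
move=> det_ge0 dist_le; have k0 : (0 < k)%N by rewrite hecke_gcd_gt0.
split; [exact: farey_point_reduced | exact: coprimez_reduced |].
rewrite farey_distE ?reduced_den_gt0// intr_farey_det_reduced -/k -/m.
rewrite divr_ge0 ?divr_ge0 ?mulr_ge0 ?ler0z//= lerBrDr.
apply: le_trans farey_radius_reduced_ge; rewrite -/k.
have sqrt_k_ge1 : 1 <= Num.sqrt (k%:R : R) by rewrite -[leLHS]sqrtr1 ler_wsqrtr// ler1n.
have rn_le : 0 < (r%:R : R) <= n%:R by rewrite ltr0n r_gt0 ler_nat rlen.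
apply: le_trans (farey_neighbour_slack sqrt_k_ge1 rn_le _); last first.
  apply: le_trans radius_ge; rewrite ler_pM2l ?ltr0n// lerD2r.
  by rewrite ler_wsqrtr// ler_nat.
rewrite sqr_sqrtr// lerD2r natr_reduced_den// -/m.
have -> : n%:R * (farey_det a b c d)%:~R / (k%:R * m%:R) / (r%:R * d%:R / m%:R) =
    n%:R * ((farey_det a b c d)%:~R / d%:R) / (r%:R * k%:R) :> R.
  by field; rewrite d_neq0 r_neq0 k_neq0 m_neq0.
rewrite ler_pM2r ?invr_gt0 ?mulr_gt0 ?ltr0n// -farey_distE//.
have -> : farey_radius R b d - n%:R = n%:R * (farey_radius R b d / n%:R - 1).
  by field.
by rewrite ler_pM2l ?ltr0n.
Qed.

End Neighbour.

End HeckeReduction.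

Theorem theorem1 (R : realType) (b n d : nat) (c a : int)
  (hb : (4 <= b)%N) (hn : (1 <= n)%N)
  (hd0 : (0 < d)%N) (hd : (d%:R : R) < b%:R `^ 3^-1)
  (hc : 0 <= c < d%:Z) (hcd : coprimez c d%:Z)
  (alpha : R) (halpha : alpha = Num.sqrt (b%:R / d%:R ^+ 3))
  (hn_alpha : n%:R `^ (3 / 2) + n%:R <= alpha)
  (hab : coprimez a b%:Z)
  (ha : 0 < (a%:~R : R) - b%:R * (c%:~R / d%:R) <= alpha / n%:R - 1) :
  forall r j : nat, (r %| n)%N -> (j < r)%N ->
  let m_rj := hecke_gcd n r j c d in
  let a_rj := reduced_num n r j a b in
  let b_rj := reduced_den n r j a b in
  let c_rj := reduced_num n r j c d in
  let d_rj := reduced_den n r j c d in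
  let S_rj := dedekind_sum R (hecke_num n r j a b) (r * b) in
  [/\ farey_neighbour R a_rj b_rj c_rj d_rj,
      S_rj = dedekind_sum R a_rj b_rj,
      0 < S_rj &
      expected_value R a_rj b_rj c_rj d_rj
        = (m_rj%:R ^+ 2 / n%:R) * expected_value R a b c d].
Proof.
move=> r j rn jr m_rj a_rj b_rj c_rj d_rj S_rj.
have r0 : (0 < r)%N by apply: leq_ltn_trans jr.
have b0 : (0 < b)%N by apply: leq_trans hb.
have /andP[dist_gt0 dist_le] := ha.
rewrite halpha -/(farey_radius R b d) in dist_le hn_alpha.
have det_gt0 : 0 < farey_det a b c d.
  by move: dist_gt0; rewrite farey_distE// pmulr_lgt0 ?invr_gt0 ?ltr0n// ltr0z.
have radius_ge : n%:R * (Num.sqrt n%:R + 1) <= farey_radius R b d.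
  by rewrite mulrDr mulr1 -powR32_sqrt.
have neighbour : farey_neighbour R a_rj b_rj c_rj d_rj.
  exact: farey_neighbour_reduced (ltW det_gt0) dist_le.
have S_eq : S_rj = dedekind_sum R a_rj b_rj.
  rewrite /S_rj -(reduced_denK n r j a b) -(reduced_numK n r j a b).
  by rewrite dedekind_sum_scale// hecke_gcd_gt0.
split=> //; last exact: expected_value_reduced.
by rewrite S_eq (dedekind_sum_gt0 neighbour) ?farey_det_reduced_gt0.
Qed.
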